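(* There is a compact set $F\subset\mathbb{R}$ such that the function $\theta\mapsto\dim_{\mathrm{A}}^{\theta}F$, $\theta\in(0,1)$, is not Hölder in any neighbourhood of $1$ (that is, for no $\eta\in(0,1)$ is it Hölder continuous, with any exponent in $(0,1]$ and any constant, on $(1-\eta,1)$).
   Context: $B(x,\delta)$ is the open ball of centre $x$ and radius $\delta$. For bounded $E\subset\mathbb{R}$ and $\delta>0$, $N_\delta(E)$ is the least number of balls of radius $\delta$ required to cover $E$. For $\theta\in(0,1)$ the Assouad spectrum of $F\subset\mathbb{R}$ is $$\dim_{\mathrm{A}}^{\theta}F=\inf\Bigl\{\alpha:(\exists C>0)(\forall\, 0<\delta\leq 1)(\forall x\in F)\ N_{\delta^{1/\theta}}(F\cap B(x,\delta))\leq C\Bigl(\frac{\delta}{\delta^{1/\theta}}\Bigr)^{\alpha}\Bigr\}.$$ *)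

(* Defs.v *)
From HB Require Import structures.
From mathcomp Require Import all_boot all_order all_algebra.
From mathcomp Require Import all_classical all_reals all_analysis.

Set Implicit Arguments.
Unset Strict Implicit.
Unset Printing Implicit Defensive.

Import Order.TTheory GRing.Theory Num.Theory.
Import numFieldNormedType.Exports.

Local Open Scope classical_set_scope.
Local Open Scope ring_scope.

Definition covered_by_balls (R : realType) (r : R) (E : set R) (n : nat) : Prop :=
  exists s : seq R, size s = n /\ E `<=` \bigcup_(y in [set` s]) ball y r.

(* Meaningful when some finite number of balls covers E, in particular for
   bounded E and 0 < r; the value is 0 by default otherwise. *)
Definition covering_number (R : realType) (r : R) (E : set R) : nat :=
  xget 0%N [set n | covered_by_balls r E n /\
                    forall m, covered_by_balls r E m -> (n <= m)%N].

(* For nonempty F and 0 < theta < 1 the set of exponents contains 1 and is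
   bounded below by 0, so the real infimum is the true one; for F = set0 every
   exponent is admissible and [inf] returns 0. *)
Definition assouad_spectrum (R : realType) (F : set R) (theta : R) : R :=
  inf [set alpha : R | exists2 C : R, 0 < C &
    forall delta : R, 0 < delta -> delta <= 1 -> forall x : R, F x ->
      (covering_number (delta `^ theta^-1) (F `&` ball x delta))%:R
        <= C * (delta / delta `^ theta^-1) `^ alpha].

Definition holder_on (R : realType) (A : set R) (beta C : R) (f : R -> R) : Prop :=
  forall s t : R, A s -> A t -> `|f s - f t| <= C * `|s - t| `^ beta.

(* Main.v *)
Require Import Defs.
From HB Require Import structures.
From mathcomp Require Import all_boot all_order all_algebra.
From mathcomp Require Import all_classical all_reals all_analysis.
From mathcomp Require Import zify lra ring.

(* Let F be the set of reals in [0, 1] whose binary digits vanish outside a set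
   S of positions.  Up to constants, covering F in a ball of radius 2 ^ - i by
   balls of radius 2 ^ - j takes 2 ^ |S in [i, j)| of them, so the spectrum at
   theta = 1 / (1 + h) is the limiting upper density of S in windows
   [t, t (1 + h)).  Take for S a union of blocks of type m, each m occurring
   infinitely often: such a block has relative length 2 ^ - m and density
   1 - 1 / (m + 2).  For h = 2 ^ - n the blocks of type n fill whole windows,
   those of type m < n are less dense, and those of type m > n cover at most
   about half of a window; hence the spectrum equals 1 - 1 / (n + 2) at
   1 / (1 + 2 ^ - n), and its increments, of order n ^ - 2, along these points
   exceed any power of their distances, which are at most 2 ^ - n. *)

Set Implicit Arguments.
Unset Strict Implicit.
Unset Printing Implicit Defensive.

Import Order.TTheory GRing.Theory Num.Theory.
Import numFieldNormedType.Exports.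

(** * Binary words with digits supported on a set of positions *)

(* The numbers below 2 ^ l whose binary digits, read from the most significant
   one and placed at positions i, ..., i + l - 1, vanish outside S. *)
Fixpoint words (S : pred nat) (i l : nat) : seq nat :=
  if l is l'.+1 then
    [seq v.*2 | v <- words S i l'] ++
    (if S (i + l') then [seq v.*2.+1 | v <- words S i l'] else [::])
  else [:: 0].

Lemma mem_wordsS (S : pred nat) (i l v : nat) :
  (v \in words S i l.+1) = (v./2 \in words S i l) && (odd v ==> S (i + l)).
Proof.
have dbl (w : nat) s : (w \in [seq u.*2 | u <- s]) = (w./2 \in s) && ~~ odd w.
  apply/mapP/andP => [[u us ->]|[ws ow]]; first by rewrite doubleK odd_double.
  by exists w./2 => //; rewrite -[LHS]odd_double_half (negbTE ow).
have dblS (w : nat) s : (w \in [seq u.*2.+1 | u <- s]) = (w./2 \in s) && odd w.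
  apply/mapP/andP => [[u us ->]|[ws ow]].
    by rewrite /= uphalf_double odd_double.
  by exists w./2 => //; rewrite -[LHS]odd_double_half ow.
rewrite /= mem_cat dbl; case: ifP => Sil; rewrite ?dblS ?in_nil ?Sil.
  by rewrite -andb_orr orNb implybT.
by rewrite orbF implybF.
Qed.

Lemma words_lt (S : pred nat) (i l v : nat) : v \in words S i l -> v < 2 ^ l.
Proof.
elim: l v => [|l IHl] v; first by rewrite inE => /eqP ->.
rewrite mem_wordsS => /andP[/IHl v2 _]; rewrite expnS. lia.
Qed.

Lemma mem0_words (S : pred nat) (i l : nat) : 0 \in words S i l.
Proof. by elim: l => // l IHl; rewrite mem_wordsS IHl. Qed.

Lemma size_words (S : pred nat) (i l : nat) :
  size (words S i l) = 2 ^ count S (iota i l).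
Proof.
elim: l => // l IHl; rewrite -addn1 iotaD count_cat expnD -IHl addn1 /=.
rewrite size_cat size_map.
by case: (S _); rewrite /= ?size_map ?addn0 ?expn1 ?expn0; lia.
Qed.

Lemma words_uniq (S : pred nat) (i l : nat) : uniq (words S i l).
Proof.
elim: l => // l IHl /=; rewrite cat_uniq map_inj_uniq ?IHl; last exact: double_inj.
case: (S _) => //=; rewrite map_inj_uniq ?IHl ?andbT; last by move=> a b; lia.
by apply/hasPn => w /mapP[u _ ->]; apply/mapP => -[u' _]; lia.
Qed.

(** Division by 2 ^ l separates the first k digits (quotient) from the last l (remainder). *)
Lemma mem_wordsD (S : pred nat) (i k l v : nat) :
  (v \in words S i (k + l)) =
  (v %/ 2 ^ l \in words S i k) && (v %% 2 ^ l \in words S (i + k) l).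
Proof.
elim: l v => [|l IHl] v; first by rewrite addn0 divn1 modn1 mem0_words andbT.
rewrite addnS !mem_wordsS IHl addnA -andbA -!divn2 -divnMA -expnS.
congr [&& _ , _ & _].
  by rewrite expnSr -modn_divl.
by rewrite odd_mod // expnS oddM.
Qed.

Lemma mem_words_shift (S : pred nat) (i l v : nat) :
  v \in words S i l -> v \in words S 0 (i + l).
Proof.
move=> vw; have v_lt := words_lt vw.
by rewrite mem_wordsD divn_small // modn_small // mem0_words add0n.
Qed.

(** * Density of the blocks in windows of positions *)

(* The block of index [k] is [4 ^ k, 4 ^ k + 2 ^ (2 k - m)) with the multiples of
   m + 2 removed; its type [m] is the 2-adic valuation of [k], so that every
   type recurs infinitely often. *)
Definition blocks : pred nat := fun l =>
  let k := trunc_log 4 l in let m := logn 2 k in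
  (l < 4 ^ k + 2 ^ (k.*2 - m)) && ~~ (m.+2 %| l).

Lemma logn2_double (k : nat) : logn 2 k <= k.*2.
Proof.
case: k => [|k]; first by rewrite lognE.
by have := ltn_logl 2 (ltn0Sn k); lia.
Qed.

(** The window holds (i + l - 1) %/ d - (i - 1) %/ d multiples of d; the additive form avoids
    truncated subtraction. *)
Lemma count_nondvd (d i l : nat) : 0 < d -> 0 < i ->
  count (fun v => ~~ (d %| v)) (iota i l) + (i + l).-1 %/ d = l + i.-1 %/ d.
Proof.
move=> d0 i0; elim: l => [|l IHl]; first by rewrite addn0.
rewrite -addn1 iotaD count_cat /= addn0 addn1 addnS /=.
have := divnS (i + l).-1 d0; rewrite prednK ?addn_gt0 ?i0 //; lia.
Qed.

Lemma count_nondvd_le (d i l : nat) : 0 < d -> 0 < i ->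
  d * count (fun v => ~~ (d %| v)) (iota i l) <= d.-1 * l + d.
Proof.
move=> d0 i0; have := count_nondvd l d0 i0.
have := leq_divM i.-1 d; have := ltn_ceil (i + l).-1 d0.
nia.
Qed.

Lemma count_nondvd_ge (d i l : nat) : 0 < d -> 0 < i ->
  d.-1 * l <= d * count (fun v => ~~ (d %| v)) (iota i l) + d.
Proof.
move=> d0 i0; have := count_nondvd l d0 i0.
have := leq_divM (i + l).-1 d; have := ltn_ceil i.-1 d0.
nia.
Qed.

(** A block has length at most 4 ^ k, hence stays below 4 ^ (k + 1), and [trunc_log 4] is k on all
    of it. *)
Lemma blocks_of_index (k l : nat) : 4 ^ k <= l < 4 ^ k + 2 ^ (k.*2 - logn 2 k) ->
  blocks l = ~~ ((logn 2 k).+2 %| l).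
Proof.
move=> /andP[kl lk]; have le4 : 2 ^ (k.*2 - logn 2 k) <= 4 ^ k.
  by rewrite (_ : 4 = 2 ^ 2) // -expnM leq_exp2l //; lia.
rewrite /blocks (@trunc_log_eq 4 k l) ?lk //.
by rewrite kl expnS; lia.
Qed.

(** Blocks end before 2 * 4 ^ k and the window lies in [i, 2 i), so l2 < 2 l1 < 4 ^ (k + 1) with k
    the index of l1. By symmetry such a window meets at most one block. *)
Lemma blocks_index (i w l1 l2 : nat) : w <= i ->
  l1 \in iota i w -> l2 \in iota i w -> blocks l1 -> blocks l2 ->
  trunc_log 4 l2 <= trunc_log 4 l1.
Proof.
rewrite !mem_iota => wi /andP[il1 l1w] /andP[il2 l2w] /andP[l1b _] /andP[l2b _].
have le4 : 2 ^ ((trunc_log 4 l1).*2 - logn 2 (trunc_log 4 l1)) <= 4 ^ trunc_log 4 l1.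
  by rewrite (_ : 4 = 2 ^ 2) // -expnM leq_exp2l //; lia.
rewrite -ltnS -(ltn_exp2l _ _ (isT : 1 < 4)) expnS.
have l2_gt0 : 0 < l2 by lia.
by have := trunc_logP (isT : 1 < 4) l2_gt0; lia.
Qed.

(** At most one block meets the window. If its type is m <= n, its density 1 - 1 / (m + 2) gives the
    left bound; otherwise its whole length is at most 4 ^ k / 2 ^ (n + 1), with 4 ^ k < i + w. *)
Lemma count_blocks_le (n i w : nat) : w <= i ->
  n.+2 * count blocks (iota i w) <= n.+1 * w + n.+2 \/
  2 ^ n.+1 * count blocks (iota i w) <= i + w.
Proof.
move=> wi.
have [/hasP[l lw lS]|/hasPn noS] := boolP (has blocks (iota i w)); last first.
  left; rewrite (_ : count _ _ = 0) ?muln0 //; apply/eqP.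
  by rewrite eqn0Ngt -has_count; apply/hasPn.
have eq_index l' : l' \in iota i w -> blocks l' -> trunc_log 4 l' = trunc_log 4 l.
  by move=> l'w l'S; apply/eqP; rewrite eqn_leq !(@blocks_index i w).
have i_gt0 : 0 < i by move: lw; rewrite mem_iota; lia.
set k := trunc_log 4 l in eq_index; set m := logn 2 k.
have l_ge : 4 ^ k <= l.
  by apply: trunc_logP => //; move: lw; rewrite mem_iota; lia.
have [mn|nm] := leqP m n; [left|right].
  have cnt : count blocks (iota i w) <= count (fun v => ~~ (m.+2 %| v)) (iota i w).
    rewrite -!size_filter uniq_leq_size ?filter_uniq ?iota_uniq // => v.
    rewrite !mem_filter => /andP[vS vw]; rewrite vw andbT.
    by move: (vS) => /andP[_]; rewrite (eq_index v).
  have := count_nondvd_le w (ltn0Sn m.+1) i_gt0.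
  (* Since the count is at most w, the bound for m weakens to the one for n. *)
  have := count_size blocks (iota i w); rewrite size_iota /=.
  nia.
have cnt : count blocks (iota i w) <= 2 ^ (k.*2 - m).
  rewrite -size_filter -[X in _ <= X](size_iota (4 ^ k)).
  apply: uniq_leq_size; first by rewrite filter_uniq ?iota_uniq.
  move=> v; rewrite mem_filter => /andP[vS vw]; rewrite mem_iota.
  move: (vS) => /andP[]; rewrite (eq_index v) // => -> _; rewrite andbT.
  rewrite -(eq_index v) //; apply: trunc_logP => //.
  by move: vw; rewrite mem_iota; lia.
have : 2 ^ n.+1 * 2 ^ (k.*2 - m) <= 4 ^ k.
  rewrite -expnD (_ : 4 = 2 ^ 2) // -expnM leq_exp2l //.
  by have := logn2_double k; rewrite -/m; lia.
move: lw; rewrite mem_iota; nia.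
Qed.

(** * Covering numbers of digit sets *)

Local Open Scope classical_set_scope.
Local Open Scope ring_scope.

Lemma covering_numberP (R : realType) (r : R) (E : set R) (n : nat) :
  covered_by_balls r E n ->
  covered_by_balls r E (covering_number r E) /\ (covering_number r E <= n)%N.
Proof.
move=> En; pose P := [pred m | `[< covered_by_balls r E m >]].
have exP : exists m, P m by exists n; apply/asboolP.
have [m /asboolP Em m_min] := ex_minnP exP.
have min_m : exists m, [set m | covered_by_balls r E m /\
    forall m', covered_by_balls r E m' -> (m <= m')%N] m.
  by exists m; split=> // m' Em'; apply/m_min/asboolP.
rewrite /covering_number; case: xgetP => [k -> [Ek kmin]|none].
  by split=> //; exact: kmin.
by case: min_m => k /none.
Qed.

(** Closed dyadic intervals at every level replace digit expansions: no expansion has to be chosen,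
    and closedness is immediate. *)
Definition digit_set (R : realType) (S : pred nat) : set R :=
  [set x | forall n, exists2 p, p \in words S 0 n &
                     p%:R <= 2 ^+ n * x <= p.+1%:R].

Lemma digit_set_compact (R : realType) (S : pred nat) :
  compact (@digit_set R S).
Proof.
apply: (subclosed_compact _ (@segment_compact R 0 1)); last first.
  move=> x /(_ 0%N) [p]; rewrite inE => /eqP ->.
  by rewrite expr0 mul1r /= in_itv.
have -> : digit_set S = \bigcap_n
    \bigcup_(p in [set` words S 0 n]) `[p%:R / 2 ^+ n : R, p.+1%:R / 2 ^+ n]%classic.
  apply/seteqP; split=> x /= xF n => [_|].
    have [p pw] := xF n; exists p => //=; rewrite in_itv /=.
    by rewrite ler_pdivrMr ?exprn_gt0 // ler_pdivlMr ?exprn_gt0 // ![x * _]mulrC.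
  have [p pw] := xF n I; rewrite /= in_itv /=.
  rewrite ler_pdivrMr ?exprn_gt0 // ler_pdivlMr ?exprn_gt0 // ![x * _]mulrC.
  by exists p.
apply: closed_bigI => n _; apply: closed_bigcup => [|p _]; last exact: itv_closed.
exact: finite_seq.
Qed.

(** At coarser levels the prefix is a truncation of q; at finer ones q is padded with zeros, which
    are always allowed. *)
Lemma words_digit_set (R : realType) (S : pred nat) (j q : nat) :
  q \in words S 0 j -> digit_set S (q%:R / 2 ^+ j : R).
Proof.
move=> qw n; have [nj|jn] := leqP n j.
  exists (q %/ 2 ^ (j - n))%N.
    by move: qw; rewrite -{1}(subnKC nj) mem_wordsD => /andP[].
  have -> : 2 ^+ n * (q%:R / 2 ^+ j) = q%:R / 2 ^+ (j - n) :> R.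
    by rewrite -{1}(subnKC nj) exprD; field; rewrite !expf_neq0.
  rewrite ler_pdivlMr ?exprn_gt0 // ler_pdivrMr ?exprn_gt0 //.
  rewrite -!natrX -!natrM !ler_nat leq_divM /=.
  by rewrite ltnW // ltn_ceil // expn_gt0.
exists (q * 2 ^ (n - j))%N.
  by rewrite -(subnKC (ltnW jn)) mem_wordsD addKn mulnK ?expn_gt0 // modnMl qw mem0_words.
have -> : 2 ^+ n * (q%:R / 2 ^+ j) = q%:R * 2 ^+ (n - j) :> R.
  by rewrite -{1}(subnKC (ltnW jn)) exprD; field; rewrite !expf_neq0.
by rewrite -natrX -natrM !ler_nat leqnn leqnSn.
Qed.

(** A point within 2 ^ - i of x has its i-digit prefix within 1 of that of x, and each of the three
    candidates has [2 ^ count S (iota i l)] extensions by l digits. *)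
Lemma digit_set_covered (R : realType) (S : pred nat) (i l : nat) (x delta r : R) :
  delta <= 2 ^- i -> 2 ^- (i + l) <= r -> digit_set S x ->
  covered_by_balls r (digit_set S `&` ball x delta) (3 * 2 ^ count S (iota i l)).
Proof.
move=> di rl xF; have [p pw /andP[p_le p_ge]] := xF i.
(* The centres are midpoints of intervals of length 2 ^ - (i + l), whose half-length is strictly
   below r. For p = 0 the list of prefixes starts at 0 and still contains 0 and 1. *)
exists [seq ((q * 2 ^ l + v)%:R + 2^-1) / 2 ^+ (i + l)
         | q <- iota p.-1 3, v <- words S i l].
rewrite size_allpairs size_iota size_words; split=> // y [yF xy].
have [s sw /andP[s_le s_ge]] := yF (i + l)%N.
move: sw; rewrite mem_wordsD add0n => /andP[_ vw].
set q := (s %/ 2 ^ l)%N; have sE := divn_eq s (2 ^ l); rewrite -/q in sE.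
have pow0 k : 0 < 2 ^+ k :> R by rewrite exprn_gt0.
have s_lt : (s < q.+1 * 2 ^ l)%N by rewrite /q ltn_ceil // expn_gt0.
have q_le : q%:R <= 2 ^+ i * y.
  rewrite -(ler_pM2r (pow0 l)) mulrAC -exprD (le_trans _ s_le) //.
  by rewrite -natrX -natrM ler_nat leq_divM.
have q_ge : 2 ^+ i * y <= q.+1%:R.
  rewrite -(ler_pM2r (pow0 l)) mulrAC -exprD (le_trans s_ge) //.
  by rewrite -natrX -natrM ler_nat.
have dxy : `|2 ^+ i * x - 2 ^+ i * y| < 1.
  rewrite -mulrBr normrM gtr0_norm // -ltr_pdivlMl // mulr1.
  exact: lt_le_trans di.
have {dxy}[xy1 xy2] : 2 ^+ i * x < 2 ^+ i * y + 1 /\ 2 ^+ i * y < 2 ^+ i * x + 1.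
  by move: dxy; rewrite ltr_norml => /andP[]; lra.
have qp : (q < p.+2)%N by rewrite -(ltr_nat R) -!natr1; move: p_ge; rewrite -natr1; lra.
have pq : (p < q.+2)%N by rewrite -(ltr_nat R) -!natr1; move: q_ge; rewrite -natr1; lra.
exists ((s%:R + 2^-1) / 2 ^+ (i + l)).
  have q_iota : q \in iota p.-1 3.
    by rewrite mem_iota; move: qp pq; clear; lia.
  rewrite sE.
  exact: (allpairs_f (fun q v => ((q * 2 ^ l + v)%:R + 2^-1) / 2 ^+ (i + l))).
rewrite /ball /=; apply: lt_le_trans rl.
rewrite -(ltr_pM2l (pow0 (i + l)%N)) -{1}(gtr0_norm (pow0 (i + l)%N)) -normrM.
rewrite mulfV ?gt_eqF // mulrBr mulrCA mulfV ?gt_eqF // mulr1 ltr_norml.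
by apply/andP; split; move: s_ge; rewrite -[s.+1%:R]natr1; lra.
Qed.

(** The points v / 2 ^ (i + l) with v in [words S i l] all lie in the set, and an open ball of
    radius 2 ^ - (i + l) contains at most two of them. *)
Lemma digit_set_covered_ge (R : realType) (S : pred nat) (i l n : nat) :
  covered_by_balls (2 ^- (i + l)) (digit_set S `&` ball (0 : R) (2 ^- i)) n ->
  (2 ^ count S (iota i l) <= n * 2)%N.
Proof.
move=> [s [<- cov]]; rewrite -size_words.
set f := fun y : R => Num.truncn (2 ^+ (i + l) * y).
rewrite -[2%N]/(size (iota 0 2)) -(size_allpairs (fun y k => f y + k)%N).
have pow0 k : 0 < 2 ^+ k :> R by rewrite exprn_gt0.
apply: uniq_leq_size => [|v vw]; first exact: words_uniq.
have [|y /= ys] := cov (v%:R / 2 ^+ (i + l)).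
  split; first exact/words_digit_set/mem_words_shift.
  rewrite /ball /= sub0r normrN ger0_norm ?divr_ge0 // ?(ltW (pow0 _)) //.
  rewrite ltr_pdivrMr // exprD mulKf ?gt_eqF //.
  by rewrite -natrX ltr_nat (words_lt vw).
rewrite /ball /= -(ltr_pM2l (pow0 (i + l)%N)) -{1}(gtr0_norm (pow0 (i + l)%N)) -normrM.
rewrite mulfV ?gt_eqF // mulrBr mulrCA mulfV ?gt_eqF // mulr1 ltr_norml => /andP[v1 v2].
have /andP[fv vf] : (f y <= v < f y + 2)%N.
  rewrite /f; set Y := 2 ^+ _ * y in v1 v2 *.
  have [Y0|Y0] := leP 0 Y.
    have /andP[t1 t2] := truncn_itv Y0.
    apply/andP; split; rewrite -ltnS -(ltr_nat R) -?natr1 ?natrD; move: t2;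
      rewrite -?natr1; lra.
  (* For negative Y the truncation is 0, and v < Y + 1 < 1 forces v = 0. *)
  have /truncn0Pn -> : ~~ (1 <= Y) by rewrite -ltNge (lt_trans Y0).
  by rewrite leq0n add0n -(ltr_nat R) /=; lra.
have vf2 : (v - f y)%N \in iota 0 2 by rewrite mem_iota; lia.
by rewrite -(subnKC fv); exact: (allpairs_f (fun y k => f y + k)%N ys vf2).
Qed.

(** * The spectrum at the points 1 / (1 + 2 ^ - n) *)

Lemma powR2_nat (R : realType) (n : nat) : 2 `^ n%:R = 2 ^+ n :> R.
Proof. by rewrite powR_mulrn // ler0n. Qed.

Lemma powR2_Nnat (R : realType) (n : nat) : 2 `^ (- n%:R) = 2 ^- n :> R.
Proof. by rewrite powRN powR2_nat. Qed.

Lemma scale_ratio_powR (R : realType) (t h alpha : R) :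
  (2 `^ (- t) / 2 `^ (- (t * (1 + h)))) `^ alpha = 2 `^ (t * h * alpha).
Proof.
rewrite -powRB; last by rewrite pnatr_eq0 implybT.
by rewrite -powRrM; congr (_ `^ _); ring.
Qed.

Lemma count_blocks_real (R : realType) (n : nat) (t : R) : (1 < n)%N -> 0 <= t ->
  let i := Num.truncn t in
  let w := ((Num.truncn (t * (1 + 2 ^- n))).+1 - i)%N in
  (count blocks (iota i w))%:R <= t * 2 ^- n * (n.+1%:R / n.+2%:R) + 3.
Proof.
move=> n1 t0; cbv zeta; set i := Num.truncn t; set w := (_.+1 - i)%N.
set h : R := 2 ^- n; set alpha : R := _ / _.
have h0 : 0 < h by rewrite invr_gt0 exprn_gt0.
have h4 : h <= 4^-1.
  rewrite lef_pV2 ?posrE ?exprn_gt0 // (_ : 4 = 2 ^+ 2) //; last by rewrite -natrX.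
  by rewrite ler_weXn2l // ler1n.
have alphaE : alpha = 1 - n.+2%:R^-1.
  by rewrite /alpha -[n.+1%:R](addrK 1) natr1 mulrBl divff ?pnatr_eq0 // mul1r.
have n2 : n.+2%:R^-1 <= 4^-1 :> R by rewrite lef_pV2 ?posrE ?ltr0n // ler_nat.
have alpha34 : 3 / 4 <= alpha by move: n2; rewrite alphaE; move: (n.+2%:R^-1) => u; lra.
have alpha1 : alpha <= 1 by rewrite alphaE lerBlDr lerDl invr_ge0 ler0n.
have th0 : 0 <= t * h by rewrite mulr_ge0 // ltW.
have th4 : t * h <= t / 4 by rewrite ler_wpM2l.
have tha : 0 <= t * h * alpha by rewrite mulr_ge0 //; lra.
have /andP[i_le i_gt] := truncn_itv t0; rewrite -/i -[i.+1%:R]natr1 in i_le i_gt.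
have t1h0 : 0 <= t * (1 + h) by rewrite mulrDr mulr1; lra.
have /andP[j_le _] := truncn_itv t1h0.
have ij : (i <= (Num.truncn (t * (1 + h))).+1)%N.
  by rewrite leqW // le_truncn // mulrDr mulr1; lra.
have iw : i%:R + w%:R <= t + t * h + 1.
  rewrite -natrD subnKC // -natr1.
  by move: j_le; rewrite mulrDr mulr1; lra.
set N := count _ _.
have Nw : (N <= w)%N by rewrite -[leqRHS](size_iota i) count_size.
(* For t < 4 the trivial bound suffices: N <= w < t h + 2 < 3. For t >= 4 the window satisfies w <=
   i, as [count_blocks_le] requires. *)
have [t4|t4] := ltP t 4.
  by have : N%:R <= w%:R :> R; [rewrite ler_nat|lra].
have wi : (w <= i)%N by rewrite -(ler_nat R); lra.
have := count_blocks_le n wi; rewrite -/N => -[le1|le2].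
  have : N%:R <= alpha * w%:R + 1.
    rewrite -(ler_pM2l (ltr0Sn R n.+1)) mulrDr mulrA mulr1 /alpha mulrCA.
    by rewrite mulfV ?pnatr_eq0 // mulr1 -!natrM -natrD ler_nat.
  have : alpha * w%:R <= alpha * (t * h + 2) by rewrite ler_wpM2l; lra.
  lra.
(* As h <= 1 / 4, the right side is at most (5 / 8) t h + 1 / 8, and alpha >= 3 / 4 absorbs its main
   term. *)
have : N%:R <= h / 2 * (i%:R + w%:R).
  rewrite /h -invfM -exprSr -ler_pdivrMl ?invr_gt0 ?exprn_gt0 // invrK.
  by rewrite -natrX -natrD -natrM ler_nat.
have : h / 2 * (i%:R + w%:R) <= h / 2 * (t + t * h + 1) by rewrite ler_wpM2l; lra.
have : t * h * h <= t * h / 4 by rewrite ler_wpM2l.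
have : t * h * (3 / 4) <= t * h * alpha by rewrite ler_wpM2l.
nra.
Qed.

Definition admissible (R : realType) (F : set R) (theta alpha : R) : Prop :=
  exists2 C : R, 0 < C &
    forall delta : R, 0 < delta -> delta <= 1 -> forall x : R, F x ->
      (covering_number (delta `^ theta^-1) (F `&` ball x delta))%:R
        <= C * (delta / delta `^ theta^-1) `^ alpha.

Lemma admissible_blocks (R : realType) (n : nat) : (1 < n)%N ->
  admissible (digit_set blocks) (1 + 2 ^- n)^-1 (n.+1%:R / n.+2%:R : R).
Proof.
(* The factor 3 counts neighbouring prefixes; 2 ^+ 3 absorbs the additive error 3 of
   [count_blocks_real]. *)
move=> n1; exists (3 * 2 ^+ 3) => [|delta d0 d1 x xF].
  by rewrite mulr_gt0 // exprn_gt0.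
have ln2 : 0 < ln 2 :> R by rewrite ln_gt0 // ltr1n.
pose t := - ln delta / ln 2.
have t0 : 0 <= t by rewrite divr_ge0 ?(ltW ln2) // oppr_ge0 ln_le0.
have dE : delta = 2 `^ (- t).
  have -> : - t = ln delta / ln 2 by rewrite /t mulNr opprK.
  by rewrite /powR pnatr_eq0 /= divfK ?gt_eqF // lnK.
have dhE : delta `^ (1 + 2 ^- n)^-1^-1 = 2 `^ (- (t * (1 + 2 ^- n))).
  by rewrite invrK dE -powRrM mulNr.
rewrite dhE {2}dE scale_ratio_powR.
have count_le := count_blocks_real n1 t0.
set i := Num.truncn t in count_le; set j := (Num.truncn _).+1 in count_le.
have th0 : 0 <= t * (1 + 2 ^- n) by rewrite mulr_ge0 // addr_ge0 // invr_ge0 exprn_ge0.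
have ij : (i <= j)%N.
  by rewrite leqW // le_truncn // ler_peMr // lerDl invr_ge0 exprn_ge0.
have d_le : delta <= 2 ^- i.
  rewrite dE -powR2_Nnat ler_powR ?ler1n // lerN2.
  by have /andP[] := truncn_itv t0.
have r_ge : 2 ^- (i + (j - i)) <= 2 `^ (- (t * (1 + 2 ^- n))).
  rewrite subnKC // -(powR2_Nnat R j) ler_powR ?ler1n // lerN2 ltW //.
  by have /andP[] := truncn_itv th0.
have [_ cov] := covering_numberP (digit_set_covered d_le r_ge xF).
rewrite -(ler_nat R) in cov; apply: (le_trans cov).
rewrite natrM natrX -mulrA ler_pM2l // -(powR2_nat R 3) -(powR2_nat R (count _ _)).
rewrite -powRD; last by rewrite pnatr_eq0 implybT.
by rewrite ler_powR ?ler1n // addrC.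
Qed.

(** The test is made at x = 0 and delta = 2 ^ - i, where i = 4 ^ k starts a block of type n: the
    window is then exactly this block, of length w = i 2 ^ - n, and w can be taken as large as
    desired. *)
Lemma admissible_blocks_ge (R : realType) (n : nat) (alpha : R) :
  admissible (digit_set blocks) (1 + 2 ^- n)^-1 alpha -> n.+1%:R / n.+2%:R <= alpha.
Proof.
move=> [C C0 adm]; rewrite leNgt; apply/negP => alpha_lt.
set a : R := _ / _ in alpha_lt.
have ln2 : 0 < ln 2 :> R by rewrite ln_gt0 // ltr1n.
(* This s makes s (a - alpha) ln 2 exceed 4 C; k has valuation n and is large enough for w >= s. *)
pose s := (Num.truncn (4 * C / ((a - alpha) * ln 2))).+1.
pose k := (2 ^ n * s.*2.+1)%N.
have kn : logn 2 k = n.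
  rewrite lognM ?expn_gt0 // pfactorK //.
  by rewrite (@logn_coprime 2 s.*2.+1) ?addn0 // coprime2n /= odd_double.
have nk : (n < k)%N.
  by rewrite (leq_trans (ltn_expl n (isT : 1 < 2)%N)) // leq_pmulr.
pose w := (2 ^ (k.*2 - n))%N; pose i := (4 ^ k)%N.
have iw : i%:R * 2 ^- n = w%:R :> R.
  rewrite /i /w (_ : 4 = 2 ^ 2)%N // -expnM mul2n -{1}(@subnK n k.*2); last by lia.
  by rewrite expnD natrM -natrX mulfK // natrX expf_neq0.
have i0 : (0 < i)%N by rewrite expn_gt0.
have F0 : digit_set blocks (0 : R).
  by have := @words_digit_set R blocks 0 0 (mem0_words _ _ _); rewrite mul0r.
have d0 : 0 < 2 ^- i :> R by rewrite invr_gt0 exprn_gt0.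
have d1 : 2 ^- i <= 1 :> R by rewrite invf_le1 ?exprn_gt0 // exprn_ege1 // ler1n.
have := adm _ d0 d1 0 F0.
have rE : (2 ^- i) `^ (1 + 2 ^- n)^-1^-1 = 2 ^- (i + w) :> R.
  rewrite invrK -(powR2_Nnat R i) -(powR2_Nnat R (i + w)) -powRrM mulNr mulrDr.
  by rewrite mulr1 iw natrD.
have ratioE : (2 ^- i / 2 ^- (i + w)) `^ alpha = 2 `^ (w%:R * alpha) :> R.
  by rewrite invrK exprD mulKf ?expf_neq0 // -powR2_nat -powRrM.
rewrite rE ratioE => cov_le.
(* The upper cover serves here only to show that a finite cover exists, so that the covering number
   is attained. *)
have [cov _] := covering_numberP
  (@digit_set_covered R blocks i w 0 _ _ (lexx _) (lexx _) F0).
have := digit_set_covered_ge cov.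
have -> : count blocks (iota i w) = count (fun v => ~~ (n.+2 %| v)%N) (iota i w).
  apply: eq_in_count => v; rewrite mem_iota => vw.
  by rewrite (@blocks_of_index k) kn.
have := count_nondvd_ge w (ltn0Sn n.+1) i0.
set N := count _ _ => N_ge; rewrite -(ler_nat R) natrM natrX => cov_ge.
have {}N_ge : w%:R * a - 1 <= N%:R.
  rewrite -(ler_pM2l (ltr0Sn R n.+1)) mulrBr mulr1 /a mulrCA (mulrC n.+1%:R).
  by rewrite mulVKf ?pnatr_eq0 // lerBlDr mulrC -!natrM -natrD ler_nat.
have pow_le : 2 `^ (w%:R * a - 1) <= 2 * C * 2 `^ (w%:R * alpha).
  apply: (@le_trans _ _ (2 `^ N%:R)); first by rewrite ler_powR ?ler1n.
  by rewrite powR2_nat (le_trans cov_ge) // mulrC -mulrA ler_pM2l.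
have pow_gt0 x : 0 < 2 `^ x :> R by rewrite powR_gt0.
(* One factor 2 comes from [digit_set_covered_ge], the other from the - 1 in the exponent. *)
have {pow_le} : 2 `^ (w%:R * (a - alpha)) <= 4 * C.
  have -> : w%:R * (a - alpha) = (w%:R * a - 1) + (1 - w%:R * alpha) by ring.
  have two0 : (2 : R) != 0 by rewrite pnatr_eq0.
  rewrite powRD ?two0 ?implybT // [2 `^ (1 - _)]powRB ?two0 ?implybT //.
  rewrite powRr1 // mulrA ler_pdivrMr //.
  move: pow_le; move: (2 `^ (w%:R * a - 1)) (2 `^ (w%:R * alpha)) => u v.
  by clear; lra.
apply/negP; rewrite -ltNge.
have : 1 + w%:R * (a - alpha) * ln 2 <= 2 `^ (w%:R * (a - alpha)).
  by rewrite /powR pnatr_eq0 /= expR_ge1Dx.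
have aa0 : 0 < (a - alpha) * ln 2 by rewrite mulr_gt0 // subr_gt0.
have : s%:R <= w%:R :> R.
  rewrite ler_nat /w (leq_trans _ (ltnW (ltn_expl _ (isT : 1 < 2)%N))) //.
  have : (s.*2.+1 <= k)%N by rewrite leq_pmull // expn_gt0.
  by move: nk; clear; clearbody k s; lia.
rewrite -(ler_pM2r aa0).
have := truncnS_gt (4 * C / ((a - alpha) * ln 2)); rewrite -/s ltr_pdivrMr //.
rewrite -mulrA; move: (2 `^ _) (s%:R * _) (w%:R * _) => u v x; clear; lra.
Qed.

Lemma assouad_spectrum_blocks (R : realType) (n : nat) : (1 < n)%N ->
  assouad_spectrum (digit_set blocks) (1 + 2 ^- n)^-1 = n.+1%:R / n.+2%:R :> R.
Proof.
move=> n1; have lb : lbound [set alpha : R |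
    admissible (digit_set blocks) (1 + 2 ^- n)^-1 alpha] (n.+1%:R / n.+2%:R).
  by move=> alpha; exact: admissible_blocks_ge.
apply/eqP; rewrite eq_le; apply/andP; split.
  by apply: ge_inf; [exists (n.+1%:R / n.+2%:R)|exact: admissible_blocks].
apply: lb_le_inf lb.
by exists (n.+1%:R / n.+2%:R); exact: admissible_blocks.
Qed.

(** * Failure of the Hölder condition near 1 *)

Theorem theoremD (R : realType) :
  exists F : set R, compact F /\
    forall eta : R, 0 < eta -> eta < 1 ->
      ~ (exists beta C : R, [/\ 0 < beta, beta <= 1 &
           holder_on `]1 - eta, 1[%classic beta C (assouad_spectrum F)]).
Proof.
exists (digit_set blocks); split; first exact: digit_set_compact.
move=> eta eta0 eta1 [beta [C [beta0 _ hol]]].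
have h0 n : 0 < 2 ^- n :> R by rewrite invr_gt0 exprn_gt0.
have theta_itv (h : R) : 0 < h -> 1 - h < (1 + h)^-1 < 1.
  move=> h_gt0; have h1 : 0 < 1 + h by lra.
  rewrite invf_lt1 // ltrDl h_gt0 andbT -[ltRHS]mul1r ltr_pdivlMr //.
  nra.
have h_decr n : 2 ^- n.+1 < 2 ^- n :> R by rewrite exprS invfM; have := h0 n; lra.
have h_small n : (0 < n)%N -> eta^-1 <= n%:R -> 2 ^- n < eta.
  move=> n0 n_ge; apply: (@lt_le_trans _ _ n%:R^-1); last first.
    by rewrite -[leRHS]invrK lef_pV2 // posrE ?ltr0n ?invr_gt0.
  by rewrite ltf_pV2 ?posrE ?exprn_gt0 ?ltr0n // -natrX ltr_nat ltn_expl.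
have ln2 : 0 < ln 2 :> R by rewrite ln_gt0 // ltr1n.
(* The increment 1 / ((n + 2) (n + 3)) over a distance at most 2 ^ - n forces 2 ^ (n beta) <= C (n +
   2) (n + 3); the bound e ^ y >= y ^ 3 / 6 then sets cubic against quadratic growth. *)
have growth n : (1 < n)%N -> eta^-1 <= n%:R ->
    (n%:R * (beta * ln 2)) ^+ 3 / 6 <= C * (n.+2%:R * n.+3%:R).
  move=> n1 n_ge; have hn := h_small n (ltnW n1) n_ge.
  have /andP[s1 s2] := theta_itv _ (h0 n).
  have /andP[t1 t2] := theta_itv _ (h0 n.+1).
  have hn' := h_decr n.
  have s_in : `]1 - eta, 1[%classic (1 + 2 ^- n : R)^-1.
    by rewrite /= in_itv /= s2 andbT; lra.
  have t_in : `]1 - eta, 1[%classic (1 + 2 ^- n.+1 : R)^-1.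
    by rewrite /= in_itv /= t2 andbT; lra.
  have := hol _ _ s_in t_in.
  rewrite (assouad_spectrum_blocks R n1) (assouad_spectrum_blocks R (leqW n1)).
  set d := `|_^-1 - _| => le_d.
  have d_le : d <= 2 ^- n by rewrite ler_norml; apply/andP; split; lra.
  have powE : (2 ^- n) `^ beta = (expR (n%:R * (beta * ln 2)))^-1.
    by rewrite -powR2_Nnat -powRrM mulNr powRN /powR pnatr_eq0 mulrA.
  have d_pow : d `^ beta <= (expR (n%:R * (beta * ln 2)))^-1.
    by rewrite -powE ge0_ler_powR ?nnegrE ?normr_ge0 // ltW.
  have n2 : 0 < n.+2%:R :> R by [].
  have n3 : 0 < n.+3%:R :> R by [].
  have {le_d} : (n.+2%:R * n.+3%:R)^-1 <= C * d `^ beta.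
    apply: le_trans le_d; rewrite distrC.
    have -> : n.+2%:R / n.+3%:R - n.+1%:R / n.+2%:R = (n.+2%:R * n.+3%:R)^-1 :> R.
      have -> : n.+1%:R = n.+2%:R - 1 :> R by rewrite -[n.+2%:R]natr1 addrK.
      have n3E : n.+3%:R = n.+2%:R + 1 :> R by rewrite natr1.
      by rewrite n3E in n3 *; field; rewrite !gt_eqF.
    exact: ler_norm.
  set P := _ * _; have P0 : 0 < P by rewrite mulr_gt0.
  have Pinv0 : 0 < P^-1 by rewrite invr_gt0.
  (* [holder_on] allows a negative C; the positive increment excludes it. *)
  move=> P_le; have C0 : 0 <= C.
    rewrite leNgt; apply/negP => /ltW C0.
    by have := mulr_le0_ge0 C0 (powR_ge0 d beta); lra.
  have {}P_le := le_trans P_le (ler_wpM2l C0 d_pow).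
  have y0 : 0 <= n%:R * (beta * ln 2) by rewrite mulr_ge0 // ltW // mulr_gt0.
  have := expR_ge1Dxn 2 y0; set E := expR _ in P_le *.
  have E_le : E <= C * P.
    by move: P_le; rewrite ler_pdivlMr ?expR_gt0 // mulrC ler_pdivrMr.
  rewrite (_ : 3`! = 6)%N //; lra.
pose b := (beta * ln 2) ^+ 3 / 6.
have b0 : 0 < b by rewrite divr_gt0 // exprn_gt0 // mulr_gt0.
(* Here n > 6 C / b gives b n ^ 3 > 6 C n ^ 2, n >= 1 / eta puts both points in the interval, and n
   >= 3 gives (n + 2) (n + 3) <= 6 n ^ 2. *)
pose n := (Num.truncn (6 * C / b) + Num.truncn eta^-1).+3.
have n_gt1 : 6 * C / b < n%:R.
  apply: (lt_le_trans (truncnS_gt _)); rewrite ler_nat ltnS.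
  by do 2! apply: leqW; exact: leq_addr.
have n_gt2 : eta^-1 <= n%:R.
  apply: (le_trans (ltW (truncnS_gt _))); rewrite ler_nat ltnS.
  by do 2! apply: leqW; exact: leq_addl.
have := growth n isT n_gt2.
have n0 : 0 < n%:R :> R by [].
have -> : (n%:R * (beta * ln 2)) ^+ 3 / 6 = b * n%:R * n%:R ^+ 2 by rewrite /b; field.
move=> bn_le; have bn0 : 0 < b * n%:R * n%:R ^+ 2 by rewrite !mulr_gt0.
have C0 : 0 <= C.
  have : 0 < C * (n.+2%:R * n.+3%:R) := lt_le_trans bn0 bn_le.
  by rewrite pmulr_lgt0 // => /ltW.
have : C * (n.+2%:R * n.+3%:R) <= C * (6 * n%:R ^+ 2).
  have quad m : (2 < m)%N -> (m.+2 * m.+3 <= 6 * m ^ 2)%N by clear; nia.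
  by rewrite ler_wpM2l // -natrX -!natrM ler_nat quad.
have : 6 * C * n%:R ^+ 2 < b * n%:R * n%:R ^+ 2.
  by rewrite ltr_pM2r ?exprn_gt0 // [b * _]mulrC -ltr_pdivrMr.
move: bn_le; lra.
Qed.
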